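(* For all $n,k\in\mathbb{N}$, the poset $B_n[k]$ is rank-log concave and has the strong Sperner property (in particular it is rank-unimodal and Sperner).
   Context: $B_n$ is the Boolean algebra of all subsets of $\{1,\dots,n\}$ ordered by inclusion. For a poset $(P,\leq)$ and $k\in\mathbb{N}$, $P[k] = \{(x_1 \leq x_2 \leq \dotsb \leq x_k) \mid x_i \in P\}$ (multichains, repetitions allowed), ordered by $(x_1 \leq \dotsb \leq x_k) \leq_k (x'_1 \leq \dotsb \leq x'_k)$ iff $x_i \leq x'_i$ for all $i$; it is graded with rank $\rho(x_1\le\dots\le x_k)=\sum_i \rho(x_i)$, ranks starting at $0$ on minimal elements. For a graded poset $P$ of rank $n$ let $P_i=\{x\in P:\rho(x)=i\}$. $P$ is rank-log concave if $|P_i|^2\geq |P_{i-1}||P_{i+1}|$ for $i=1,\dots,n-1$. $P$ has the $m$-Sperner property if no union of $m$ antichains of $P$ has more elements than the union of the $m$ largest levels $P_i$; it has the strong Sperner property if it has the $m$-Sperner property for all $m\in\mathbb{N}$. *)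

(* Defs.v *)
From HB Require Import structures.
From mathcomp Require Import all_boot all_order.

Set Implicit Arguments.
Unset Strict Implicit.
Unset Printing Implicit Defensive.

Import Order.TTheory.
Local Open Scope order_scope.

Section Covering.
Context {d : Order.disp_t} {P : finPOrderType d}.
Implicit Types x y : P.

Definition minimal x : Prop := forall y, ~~ (y < x).
Definition maximal x : Prop := forall y, ~~ (x < y).
Definition covers x y : Prop := x < y /\ forall z, ~~ (x < z < y).

End Covering.

(* Ranks start at 0 on minimal elements and increase by one along coverings;
   rank_maximal says that all maximal chains have the same length, which is
   the rank of the poset. *)
HB.mixin Record isGraded d P of Order.FinPOrder d P := {
  rank : P -> nat;
  poset_rank : nat;
  rank_minimal : forall x, minimal x -> rank x = 0%N;
  rank_covers : forall x y, covers x y -> rank y = (rank x).+1;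
  rank_maximal : forall x, maximal x -> rank x = poset_rank
}.

#[short(type="gradedPosetType")]
HB.structure Definition Graded d := { P of isGraded d P & Order.FinPOrder d P }.

Arguments poset_rank {d} s : rename.

Section Levels.
Context {d : Order.disp_t} (P : gradedPosetType d).

Definition level (i : nat) : {set P} := [set x : P | rank x == i].

Definition rank_log_concave : Prop :=
  forall i, (0 < i < poset_rank P)%N ->
    (#|level i.-1| * #|level i.+1| <= #|level i| ^ 2)%N.

Definition rank_unimodal : Prop :=
  exists2 p, (p <= poset_rank P)%N &
    (forall i, (i < p)%N -> (#|level i| <= #|level i.+1|)%N) /\
    (forall i, (p <= i < poset_rank P)%N -> (#|level i.+1| <= #|level i|)%N).

Definition antichain (A : {set P}) : Prop :=
  {in A &, forall x y, x != y -> x >< y}.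

(* The ranks of the m largest levels, or all ranks if there are fewer than m. *)
Definition largest_levels (m : nat) : seq nat :=
  take m (sort (fun i j => #|level j| <= #|level i|)%N
               (iota 0 (poset_rank P).+1)).

Definition m_Sperner (m : nat) : Prop :=
  forall A : 'I_m -> {set P}, (forall j, antichain (A j)) ->
    (#|\bigcup_j A j| <= #|\bigcup_(i <- largest_levels m) level i|)%N.

Definition Sperner : Prop := m_Sperner 1.

Definition strong_Sperner : Prop := forall m, m_Sperner m.

End Levels.

(* B_n, with ground set 'I_n = {0, ..., n-1}, ordered by inclusion. *)
Definition boolean_algebra (n : nat) : Type := {set 'I_n}.

Section BooleanOrder.
Import Order.DefaultSetSubsetOrder.

HB.instance Definition _ n :=
  Order.CTBDistrLattice.copy (boolean_algebra n) {set 'I_n}.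
HB.instance Definition _ n := Finite.copy (boolean_algebra n) {set 'I_n}.

End BooleanOrder.

Section BooleanAlgebra.
Variable n : nat.
Implicit Types A B : boolean_algebra n.

Lemma leEboolean A B : (A <= B) = ((A : {set 'I_n}) \subset B).
Proof. by []. Qed.

Let setrank (A : boolean_algebra n) : nat := #|(A : {set 'I_n})|.

Fact setrank_minimal A : minimal A -> setrank A = 0%N.
Proof.
move=> minA; apply/eqP; rewrite /setrank cards_eq0.
have := minA \bot; rewrite lt_def le0x andbT negbK => /eqP ->.
exact: eqxx.
Qed.

Fact setrank_covers A B : covers A B -> setrank B = (setrank A).+1.
Proof.
case=> ltAB covAB; have := ltAB; rewrite lt_neqAle => /andP[neAB].
rewrite leEboolean => sAB.
have /properP[_ [a aB aA]] : (A : {set 'I_n}) \proper B by rewrite properEneq neAB.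
have leaA : (a |: A : {set 'I_n}) \subset B by rewrite subUset sub1set aB.
have ltAa : A < (a |: A : {set 'I_n}).
  rewrite lt_neqAle leEboolean subsetUr andbT; apply: contraNneq aA => ->.
  exact: setU11.
have := covAB (a |: A : {set 'I_n}); rewrite ltAa /= lt_neqAle leEboolean leaA andbT.
by rewrite negbK /setrank => /eqP <-; rewrite cardsU1 aA.
Qed.

Fact setrank_maximal A : maximal A -> setrank A = n.
Proof.
move=> maxA; have := maxA \top; rewrite lt_neqAle lex1 andbT negbK => /eqP ->.
have -> : setrank \top = #|[set: 'I_n]| by [].
by rewrite cardsT card_ord.
Qed.

HB.instance Definition _ := isGraded.Build _ (boolean_algebra n)
  setrank_minimal setrank_covers setrank_maximal.

End BooleanAlgebra.

(* P[k]; its order is the one induced by the componentwise order on tuples. *)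
Record multichain d (P : finPOrderType d) (k : nat) := Multichain {
  multichain_tuple :> k.-tuple P;
  multichain_sorted : sorted <=%O multichain_tuple
}.

Section Multichain.
Import Order.DefaultTupleProdOrder.
Context {d : Order.disp_t} {P : finPOrderType d} {k : nat}.
Implicit Types x y : multichain P k.

HB.instance Definition _ := [isSub for @multichain_tuple d P k].
HB.instance Definition _ := [Finite of multichain P k by <:].
HB.instance Definition _ :=
  [SubChoice_isSubPOrder of multichain P k by <: with Order.seqprod_display d].

Lemma le_multichain x y :
  (x <= y) = [forall i, tnth x i <= tnth y i].
Proof. by rewrite -Order.le_val; apply: leEtprod. Qed.

Lemma multichain_le x (i j : 'I_k) : (i <= j)%N -> tnth x i <= tnth x j.
Proof.
have x0 := tnth x i; move=> leij; rewrite !(tnth_nth x0).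
by apply: (sorted_leq_nth le_trans le_refl) (multichain_sorted x) _ _ _ _ leij;
  rewrite inE size_tuple.
Qed.

Lemma sorted_tuple_le (t : k.-tuple P) :
  (forall i j : 'I_k, (i < j)%N -> tnth t i <= tnth t j) -> sorted <=%O t.
Proof.
case: k t => [|k'] t le_t; first by rewrite tuple0.
have x0 := tnth t ord0; apply/(sortedP x0) => i; rewrite size_tuple => lti.
by have := le_t (Ordinal (ltnW lti)) (Ordinal lti) (ltnSn i); rewrite !(tnth_nth x0).
Qed.

Fact const_sorted (c : P) : sorted <=%O [tuple c | _ < k].
Proof. by apply: sorted_tuple_le => i j _; rewrite !tnth_mktuple. Qed.
Let const c : multichain P k := @Multichain _ P k [tuple c | _ < k] (const_sorted c).

Lemma const_multichain_eq x c : x = const c -> forall i, tnth x i = c.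
Proof. by move=> -> i; rewrite tnth_mktuple. Qed.

Lemma minimal_multichain x i : minimal x -> minimal (tnth x i).
Proof.
move=> minx.
have k_gt0 : (0 < k)%N by case: i => i; apply: leq_ltn_trans.
pose i0 := Ordinal k_gt0.
have low c : c <= tnth x i0 -> forall j, tnth x j = c.
  move=> le_c; apply: const_multichain_eq.
  have := minx (const c); rewrite lt_neqAle negb_and negbK => /orP[/eqP // | /negP[]].
  rewrite le_multichain; apply/forallP => j; rewrite tnth_mktuple.
  by apply: le_trans le_c _; apply: multichain_le.
move=> z; apply/negP; rewrite (low _ (lexx _) i) => ltz.
by have := low _ (ltW ltz) i0 => eqz; rewrite eqz ltxx in ltz.
Qed.

Lemma maximal_multichain x i : maximal x -> maximal (tnth x i).
Proof.
move=> maxx.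
have k_gt0 : (0 < k)%N by case: i => i; apply: leq_ltn_trans.
have ltk : (k.-1 < k)%N by rewrite prednK.
pose i1 := Ordinal ltk.
have high c : tnth x i1 <= c -> forall j, tnth x j = c.
  move=> le_c; apply: const_multichain_eq.
  have := maxx (const c); rewrite lt_neqAle negb_and negbK => /orP[/eqP // | /negP[]].
  rewrite le_multichain; apply/forallP => j; rewrite tnth_mktuple.
  apply: le_trans le_c; apply: multichain_le.
  by rewrite /= -ltnS prednK.
move=> z; apply/negP; rewrite (high _ (lexx _) i) => ltz.
by have := high _ (ltW ltz) i1 => eqz; rewrite eqz ltxx in ltz.
Qed.

Lemma covers_multichain x y : covers x y ->
  exists2 i, covers (tnth x i) (tnth y i) &
    forall j, j != i -> tnth y j = tnth x j.
Proof.
case=> ltxy covxy.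
have lexy j : tnth x j <= tnth y j.
  by have := ltW ltxy; rewrite le_multichain => /forallP.
have [i0 ne0] : exists i, tnth x i != tnth y i.
  apply/existsP; apply: contraLR ltxy; rewrite negb_exists => /forallP eqxy.
  suff -> : x = y by rewrite ltxx.
  by apply/val_inj/eq_from_tnth => j; apply/eqP; have := eqxy j; rewrite negbK.
case: (@arg_maxnP _ i0 (fun i => tnth x i != tnth y i) (@nat_of_ord k) ne0).
move=> i nei maxi.
pose upd c : k.-tuple P := [tuple if j == i then c else tnth x j | j < k].
have upd_sorted c : tnth x i <= c -> c <= tnth y i -> sorted <=%O (upd c).
  move=> lexc lecy; apply: sorted_tuple_le => j1 j2 lt12; rewrite !tnth_mktuple.
  case: eqP => [e1|_]; case: eqP => [e2|_].
  - by [].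
  - subst j1; have -> : tnth x j2 = tnth y j2.
      by apply/eqP; apply: contraLR lt12 => /maxi; rewrite -leqNgt.
    by apply: le_trans lecy _; apply: multichain_le; apply: ltnW.
  - by subst j2; apply: le_trans lexc; apply: multichain_le; apply: ltnW.
  - by apply: multichain_le; apply: ltnW.
have upd_eq c : tnth x i < c -> c <= tnth y i ->
    forall j, tnth y j = if j == i then c else tnth x j.
  move=> ltxc lecy.
  pose z : multichain P k := @Multichain _ P k (upd c) (upd_sorted c (ltW ltxc) lecy).
  have zE j : tnth z j = if j == i then c else tnth x j by rewrite tnth_mktuple.
  have ltxz : x < z.
    rewrite lt_neqAle; apply/andP; split.
      apply/eqP => xz; have := zE i; rewrite eqxx -xz => xic.
      by have := ltxc; rewrite xic ltxx.
    rewrite le_multichain; apply/forallP => j; rewrite zE.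
    by case: eqP => // ->; apply: ltW.
  have lezy : z <= y.
    by rewrite le_multichain; apply/forallP => j; rewrite zE; case: eqP => // ->.
  have := covxy z; rewrite ltxz /= lt_neqAle lezy andbT negbK => /eqP <- j.
  exact: zE.
have ltxyi : tnth x i < tnth y i by rewrite lt_neqAle nei lexy.
exists i.
  split=> // c; apply/negP => /andP[ltxc ltcy].
  by have := upd_eq c ltxc (ltW ltcy) i; rewrite eqxx => e; rewrite e ltxx in ltcy.
by move=> j neji; rewrite (upd_eq _ ltxyi (lexx _)) (negbTE neji).
Qed.

End Multichain.

Section GradedMultichain.
Context {d : Order.disp_t} {P : gradedPosetType d} {k : nat}.
Implicit Types x y : multichain P k.

Let mrank (x : multichain P k) : nat := (\sum_(i < k) rank (tnth x i))%N.

Fact mrank_minimal x : minimal x -> mrank x = 0%N.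
Proof.
by move=> minx; apply: big1 => i _; apply/rank_minimal/minimal_multichain.
Qed.

Fact mrank_covers x y : covers x y -> mrank y = (mrank x).+1.
Proof.
case/covers_multichain => i covi eqj.
rewrite /mrank (bigD1 i) //= (rank_covers _ _ covi) [in RHS](bigD1 i) //= addSn.
by congr (_ + _).+1; apply: eq_bigr => j /eqj ->.
Qed.

Fact mrank_maximal x : maximal x -> mrank x = (k * poset_rank P)%N.
Proof.
move=> maxx; rewrite -[k in RHS]card_ord -sum_nat_const.
by apply: eq_bigr => i _; apply/rank_maximal/maximal_multichain.
Qed.

HB.instance Definition _ := isGraded.Build _ (multichain P k)
  mrank_minimal mrank_covers mrank_maximal.

End GradedMultichain.

(* Main.v *)
(* Sending a multichain x_1 <= ... <= x_k of B_n to its heights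
   a |-> #{i | a in x_i} identifies B_n[k] with the n-th power of the chain
   0 < 1 < ... < k.  This power has a symmetric chain decomposition, built one
   factor at a time.  A chain of ranks b, ..., N - b either lies in the m middle
   levels or meets each of them, whereas a union of m antichains meets it at
   most m times; summing over the chains bounds the union by the m middle
   levels, hence by the m largest ones.  The level sizes are the coefficients of
   (1 + X + ... + X^k)^n, and multiplication by 1 + X + ... + X^k, that is,
   summation over a sliding window, preserves log-concavity. *)

Require Import Defs.
From mathcomp Require Import all_boot all_order all_algebra zify lra.

Set Implicit Arguments.
Unset Strict Implicit.
Unset Printing Implicit Defensive.

(** * Greedy choice of the largest levels *)

Section LargestSums.
Variables (T : eqType) (w : T -> nat).
Implicit Types s t : seq T.

(** Exchange argument: the head of [s] weighs at least as much as some [y] in [t], taken to be the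
    head itself if it occurs there, so that [rem y t] lies in the tail of [s]. *)
Lemma leq_sum_take_sorted s t m :
  sorted (fun x y => w y <= w x) s -> uniq t -> {subset t <= s} -> size t <= m ->
  \sum_(x <- t) w x <= \sum_(x <- take m s) w x.
Proof.
elim: s t m => [|x s IHs] t m sorted_s uniq_t sub_t size_t.
  by case: t sub_t {uniq_t size_t} => [|y t] // /(_ y (mem_head y t)).
case: t uniq_t sub_t size_t => [|y0 t0]; first by rewrite big_nil.
have := mem_head y0 t0; move: {t0}(y0 :: t0) => t y0t uniq_t sub_t.
case: m => [|m] size_t; first by case: t y0t size_t {uniq_t sub_t}.
have [y yt [leyx sub_rem]] :
    exists2 y, y \in t & w y <= w x /\ {subset rem y t <= s}.
  have [xt|xNt] := boolP (x \in t).
    exists x => //; split=> // z; rewrite mem_rem_uniq // inE => /andP[nezx /sub_t].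
    by rewrite inE (negbTE nezx).
  have sub_ts : {subset t <= s}.
    move=> z zt; have := sub_t z zt; rewrite inE => /orP[/eqP zx|//].
    by rewrite -zx zt in xNt.
  exists y0 => //.
  split; last by move=> z /mem_rem /sub_ts.
  have tr : transitive (fun x y => w y <= w x).
    by move=> a b c leab lebc; apply: leq_trans lebc leab.
  by have /allP := order_path_min tr sorted_s; apply; apply: sub_ts.
rewrite /= (perm_big _ (perm_to_rem yt)) !big_cons leq_add //.
apply: IHs; rewrite ?rem_uniq //; first exact: path_sorted sorted_s.
by rewrite size_rem // -subn1 leq_subLR.
Qed.

End LargestSums.

Lemma card_bigcupI_leq (I T : finType) (A : I -> {set T}) (F : {set T}) :
  #|\bigcup_i A i :&: F| <= \sum_i #|A i :&: F|.
Proof.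
elim/big_rec2: _ => [|i a U _ leUa]; first by rewrite set0I cards0.
by rewrite setIUl (leq_trans (leq_card_setU _ _)) // leq_add2l.
Qed.

Section Levels.
Variables (d : Order.disp_t) (P : gradedPosetType d).

Local Notation N := (poset_rank P).

Lemma bigcup_level (s : seq nat) :
  \bigcup_(i <- s) level P i = [set x | rank x \in s].
Proof.
elim: s => [|i s IHs]; first by rewrite big_nil; apply/setP=> x; rewrite !inE.
by rewrite big_cons IHs; apply/setP=> x; rewrite !inE.
Qed.

Lemma card_bigcup_level (s : seq nat) : uniq s ->
  #|\bigcup_(i <- s) level P i| = \sum_(i <- s) #|level P i|.
Proof.
elim: s => [|i s IHs] /=; first by rewrite !big_nil cards0.
case/andP=> iNs uniq_s; rewrite !big_cons -IHs // cardsU.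
suff -> : level P i :&: \bigcup_(j <- s) level P j = set0 by rewrite cards0 subn0.
rewrite bigcup_level; apply/setP=> x; rewrite !inE.
by case: eqP => //= ->; apply: negbTE.
Qed.

Lemma card_level_largest m (s : seq nat) :
  uniq s -> size s <= m -> {subset s <= iota 0 N.+1} ->
  #|[set x : P | rank x \in s]| <= #|\bigcup_(i <- largest_levels P m) level P i|.
Proof.
move=> uniq_s size_s sub_s.
rewrite -bigcup_level !card_bigcup_level ?take_uniq ?sort_uniq ?iota_uniq //.
apply: leq_sum_take_sorted => //; last by move=> i /sub_s; rewrite mem_sort.
by apply: sort_sorted => i j; apply: leq_total.
Qed.

End Levels.

(** * Consequences of a symmetric chain decomposition *)

Section SymmetricChainDecomposition.
Variables (d : Order.disp_t) (P : gradedPosetType d) (T : finType).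
Variables (chain : P -> T) (bottom : T -> nat).

Local Notation N := (poset_rank P).

Hypothesis chain_le : forall x y,
  chain x = chain y -> rank x <= rank y -> (x <= y)%O.
Hypothesis chain_rank : forall x,
  bottom (chain x) <= rank x <= N - bottom (chain x).
Hypothesis chain_saturated : forall x r,
  bottom (chain x) <= r <= N - bottom (chain x) ->
  exists2 y, chain y = chain x & rank y = r.

Lemma card_chains (A : {set P}) :
  #|A| = \sum_t #|A :&: [set x | chain x == t]|.
Proof.
rewrite -sum1_card (partition_big chain predT) //=.
apply: eq_bigr => t _; rewrite -sum1_card.
by apply: eq_bigl => x; rewrite !inE.
Qed.

Lemma card_antichain_chain (A : {set P}) t :
  antichain A -> #|A :&: [set x | chain x == t]| <= 1.
Proof.
move=> antiA; apply/card_le1_eqP => x y.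
rewrite !inE => /andP[xA /eqP cx] /andP[yA /eqP cy].
apply/eqP; apply: contraT => neq_xy; have /negP[] := antiA y x yA xA neq_xy.
apply/orP.
by case/orP: (leq_total (rank y) (rank x)) => /chain_le le_xy; [left|right];
  apply: le_xy; rewrite cx cy.
Qed.

Lemma scd_strong_Sperner : strong_Sperner P.
Proof.
move=> m A antiA.
(* The ranks of the m middle levels. *)
pose s := iota (N.+1 - m)./2 (minn m N.+1).
apply: (@leq_trans #|[set x : P | rank x \in s]|); last first.
  apply: card_level_largest; rewrite ?iota_uniq ?size_iota ?geq_minl //.
  by move=> i; rewrite !mem_iota; lia.
rewrite [leqLHS]card_chains [leqRHS]card_chains; apply: leq_sum => t _.
set F := [set x | chain x == t].
have [/existsP[x /andP[xF rank_xNs]]|] :=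
    boolP [exists x, (x \in F) && (rank x \notin s)].
  apply: (@leq_trans m).
    apply: (@leq_trans (\sum_(j < m) #|A j :&: F|)); last first.
      rewrite -[leqRHS]card_ord -sum1_card.
      by apply: leq_sum => j _; apply: card_antichain_chain.
    exact: card_bigcupI_leq.
  (* A rank outside [s] shows that [s] is not all of 0, ..., N, so the minimum is [m]. *)
  have -> : m = size s.
    move: rank_xNs (chain_rank x); rewrite size_iota mem_iota; lia.
  have := xF; rewrite inE => /eqP cx.
  rewrite -(size_image (@rank d P)); apply: uniq_leq_size; first exact: iota_uniq.
  (* By symmetry about N / 2, a chain leaving [s] on either side spans [s], even when parity puts
     [s] half a step off centre. *)
  move=> r rs; have [|y cy ry] := @chain_saturated x r.
    move: rank_xNs rs (chain_rank x); rewrite !mem_iota; lia.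
  by rewrite -ry; apply: image_f; rewrite !inE ry rs cy cx eqxx.
rewrite negb_exists => /forallP sub_s; apply/subset_leq_card/subsetP => x.
rewrite !inE => /andP[_ xF]; have := sub_s x.
by rewrite inE xF /= negbK => ->.
Qed.

(** The chain through a point of level [i] also meets level [j], and no chain meets a level
    twice. *)
Lemma leq_level_chain i j : i <= j <= N - i \/ N - i <= j <= i ->
  #|level P i| <= #|level P j|.
Proof.
move=> ij.
have inj r : {in level P r &, injective chain}.
  move=> x y; rewrite !inE => /eqP rx /eqP ry cxy.
  by apply/Order.POrderTheory.le_anti; rewrite !chain_le ?rx ?ry.
rewrite -(card_in_imset (inj i)) -(card_in_imset (inj j)).
apply/subset_leq_card/subsetP => t /imsetP[x]; rewrite inE => /eqP rx ->.
have [|y <- ry] := @chain_saturated x j; last by apply: imset_f; rewrite inE ry.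
by have := chain_rank x; rewrite rx; lia.
Qed.

Lemma scd_rank_unimodal : rank_unimodal P.
Proof.
exists N./2; first lia.
by split=> i lei; apply: leq_level_chain; lia.
Qed.

End SymmetricChainDecomposition.

(** * Symmetric chains of words over 0, ..., k *)

Section WordChains.
Variable k : nat.
Implicit Types u v w : seq nat.

(* The label identifies the chain of a word, whose lowest element has rank the
   sum of the label.  If C is the chain of w', of ranks b, ..., D, then the
   grid [0, k] x C is cut into hooks: the j-th one runs through (j, c) with
   rank c <= D - j, then through (t, c) with rank c = D - j and t > j. *)
Fixpoint label w : seq nat :=
  if w is t :: w' then
    minn t (k * size w' - sumn (label w') - sumn w') :: label w'
  else [::].

Lemma size_label w : size (label w) = size w.
Proof. by elim: w => //= t w ->. Qed.

(** Over a chain of ranks b to D, the j-th hook has ranks b + j to k + D - j; since b + D = k * size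
    w', it is symmetric again. *)
Lemma label_rank w : all (leq^~ k) w ->
  sumn (label w) <= sumn w <= k * size w - sumn (label w).
Proof.
elim: w => //= t w IHw /andP[let_k /IHw{IHw}].
rewrite mulnS; lia.
Qed.

Lemma label_le u v : all (leq^~ k) u -> all (leq^~ k) v ->
  label u = label v -> sumn u <= sumn v -> all2 leq u v.
Proof.
elim: u v => [|t u IHu] [|t' v] //= /andP[tk ku] /andP[t'k kv] [eq_min eq_label].
have sz : size u = size v by rewrite -size_label eq_label size_label.
have := label_rank ku; have := label_rank kv.
rewrite sz eq_label in eq_min *.
(* Both coordinates are nondecreasing along a hook; [ru] and [rv] make the truncated subtractions
   exact. *)
move=> rv ru le_sum; have [le_t le_uv] : t <= t' /\ sumn u <= sumn v by lia.
by rewrite le_t IHu.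
Qed.

Lemma label_saturated w r : all (leq^~ k) w ->
  sumn (label w) <= r <= k * size w - sumn (label w) ->
  exists v, [/\ all (leq^~ k) v, label v = label w & sumn v = r].
Proof.
elim: w r => [|t w IHw] r /=.
  by move=> _; rewrite muln0 leqn0 => /eqP ->; exists [::].
case/andP=> tk kw; have := label_rank kw; rewrite mulnS.
set a := sumn (label w) in IHw *; set D := k * size w - a in IHw *.
move=> rank_w; set j := minn _ _ => range_r.
(* The corner of the hook has rank [D]: up to it the first letter stays [j], beyond it the tail
   keeps rank [D - j]. *)
have [le_rD|lt_Dr] := leqP r D.
  have [|v [kv lab_v sum_v]] := IHw (r - j) kw; first by lia.
  have sz : size v = size w by rewrite -size_label lab_v size_label.
  exists (j :: v); split=> /=; [by rewrite kv andbT; lia| |by lia].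
  by rewrite lab_v sz sum_v -/a -/D; congr (_ :: _); lia.
have [|v [kv lab_v sum_v]] := IHw (D - j) kw; first by lia.
have sz : size v = size w by rewrite -size_label lab_v size_label.
exists (r - D + j :: v); split=> /=; [by rewrite kv andbT; lia| |by lia].
by rewrite lab_v sz sum_v -/a -/D; congr (_ :: _); lia.
Qed.

End WordChains.

(** * Log-concavity under sliding windows *)

Section LogConcave.
Import Order.TTheory GRing.Theory Num.Theory.
Local Open Scope ring_scope.
Implicit Types f : int -> int.

(* Stronger than the case a = b: it also rules out internal zeros, which is what
   makes it stable under windows. *)
Definition log_concave f := forall a b, a <= b -> f (a - 1) * f (b + 1) <= f a * f b.

Definition window k f (z : int) : int := \sum_(t < k.+1) f (z - t%:Z).

Lemma log_concave_shift f (m : nat) a b : log_concave f -> a <= b ->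
  f (a - m%:Z) * f (b + m%:Z) <= f a * f b.
Proof.
move=> lcf; elim: m a b => [|m IHm] a b leab; first by rewrite subr0 addr0.
have -> : a - m.+1%:Z = a - m%:Z - 1 by lia.
have -> : b + m.+1%:Z = b + m%:Z + 1 by lia.
apply: le_trans (lcf _ _ _) (IHm _ _ leab); lia.
Qed.

(** Pairs with equal sums are concentric, so the outer one is the inner one moved apart. *)
Lemma log_concave_between f p q r s : log_concave f ->
  p <= q -> p <= r -> p + s = q + r -> f p * f s <= f q * f r.
Proof.
move=> lcf; wlog leqr : q r / q <= r => [IH lepq lepr e|lepq lepr e].
  have [leqr|ltrq] := leP q r; first exact: IH.
  by rewrite [leRHS]mulrC; apply: IH => //; [apply: ltW | rewrite e addrC].
have -> : p = q - `|q - p|%N%:Z by lia.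
have -> : s = r + `|q - p|%N%:Z by lia.
exact: log_concave_shift.
Qed.

Lemma windowS k f z : window k f (z + 1) = window k f z + f (z + 1) - f (z - k%:Z).
Proof.
rewrite /window big_ord_recl [in RHS]big_ord_recr /= subr0.
have -> : \sum_(i < k) f (z + 1 - (bump 0 i)%:Z) = \sum_(i < k) f (z - i%:Z).
  by apply: eq_bigr => i _; congr f; rewrite /bump; lia.
by rewrite [in RHS]addrAC addrK addrC.
Qed.

Lemma log_concave_window k f : log_concave f -> log_concave (window k f).
Proof.
move=> lcf a b leab.
have := windowS k f (a - 1); rewrite subrK => ->; rewrite windowS.
(* Cancelling ga * gb, the claim is the sum of h1 and h2, which hold termwise. *)
set ga := window k f (a - 1); set gb := window k f b.
have h1 : ga * f (b + 1) <= gb * f a.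
  rewrite /ga /gb /window !mulr_suml; apply: ler_sum => t _.
  rewrite [leRHS]mulrC; apply: log_concave_between => //; lia.
have h2 : gb * f (a - 1 - k%:Z) <= ga * f (b - k%:Z).
  rewrite /ga /gb /window !mulr_suml; apply: ler_sum => t _.
  (* The bound on [t] makes [a - 1 - k] the smallest of the four indices. *)
  rewrite mulrC; have := ltn_ord t => ltt; apply: log_concave_between => //; lia.
lra.
Qed.

(** Extension by zero lets windows reach below index 0. *)
Definition coefz (p : {poly int}) (z : int) : int := if z is Posz i then p`_i else 0.

Lemma coefz_window k p :
  coefz (p * \sum_(t < k.+1) 'X^t) =1 window k (coefz p).
Proof.
move=> z; rewrite /window mulr_sumr; case: z => [i|i] /=; last first.
  rewrite big1 // => t _; by have -> : Negz i - t%:Z = Negz (i + t) by lia.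
rewrite coef_sum; apply: eq_bigr => t _; rewrite coefMXn.
case: ltnP => [ltit|leti]; last by rewrite subzn.
by have -> : i%:Z - t%:Z = Negz (t - i).-1 by lia.
Qed.

Lemma log_concave_coefz k n : log_concave (coefz ((\sum_(t < k.+1) 'X^t) ^+ n)).
Proof.
elim: n => [|n IHn] a b leab.
  rewrite expr0 /coefz.
  (* As a - 1 < b + 1, the only nonzero coefficient of 1 cannot sit at both indices, and the
     left-hand side vanishes. *)
  by case: a b leab => [[|a]|a] [[|b]|b] //= _; rewrite ?coef1 ?mulr0 ?mul0r.
by rewrite exprSr !coefz_window; apply: log_concave_window.
Qed.

(** Distributivity: picking the term of exponent [f a] in each factor [a] contributes one monomial,
    of degree the sum of [f]. *)
Lemma coef_exp_geometric k n i :
  ((\sum_(t < k.+1) 'X^t : {poly int}) ^+ n)`_i =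
  #|[set f : {ffun 'I_n -> 'I_k.+1} | (\sum_a f a == i)%N]|%:R.
Proof.
rewrite -[n in LHS]card_ord -prodr_const bigA_distr_bigA /= coef_sum.
rewrite -sum1_card natr_sum [RHS]big_mkcond /=; apply: eq_bigr => f _.
by rewrite inE prodrXr coefXn eq_sym; case: eqP.
Qed.

End LogConcave.

(** * Multichains of subsets as words of heights *)

Lemma card_sum_mem (T : finType) (A : {set T}) : #|A| = \sum_x (x \in A).
Proof. by rewrite -sum1_card big_mkcond; apply: eq_bigr => x _; case: ifP. Qed.

Lemma card_ord_geq k m : #|[set i : 'I_k | k <= m + i]| = minn m k.
Proof.
rewrite card_sum_mem; under eq_bigr do rewrite inE.
elim: k => [|k IHk]; first by rewrite big_ord0 minn0.
rewrite big_ord_recl (eq_bigr (fun i : 'I_k => (k <= m + i : nat))) => [|i _].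
  by rewrite IHk /=; lia.
by rewrite lift0 addnS ltnS.
Qed.

Section BooleanMultichains.
Variables n k : nat.
Local Notation M := (multichain (boolean_algebra n) k).
Implicit Types x y : M.

Definition height x (a : 'I_n) : nat := #|[set i | a \in (tnth x i : {set 'I_n})]|.

Lemma height_leq x a : height x a <= k.
Proof. by rewrite -[leqRHS]card_ord max_card. Qed.

Lemma rank_height x : rank x = \sum_a height x a.
Proof.
have -> : rank x = \sum_(i < k) \sum_a (a \in (tnth x i : {set 'I_n})).
  by apply: eq_bigr => i _; apply: card_sum_mem.
rewrite exchange_big; apply: eq_bigr => a _.
by rewrite /height card_sum_mem; apply: eq_bigr => i _; rewrite inE.
Qed.

(** Along a multichain no element is ever lost, so [a] belongs to exactly the last [height x a]
    sets. *)
Lemma mem_height x a i : (a \in (tnth x i : {set 'I_n})) = (k <= height x a + i).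
Proof.
have tail_le m : m <= k -> #|[set j : 'I_k | k <= m + j]| = m.
  by rewrite card_ord_geq => /minn_idPl.
have lt_ik := ltn_ord i.
apply/idP/idP => [ai|le_h].
  have : k - i <= height x a; last by lia.
  rewrite -[leqLHS]tail_le ?leq_subr //; apply/subset_leq_card/subsetP => j.
  rewrite !inE => le_ij; have le_ij' : i <= j by lia.
  by have := multichain_le x le_ij'; rewrite leEboolean => /subsetP; apply.
apply: contraLR le_h => aNi; rewrite -ltnNge.
have : height x a <= k - i.+1; last by lia.
rewrite -[leqRHS]tail_le ?leq_subr //; apply/subset_leq_card/subsetP => j.
rewrite !inE => aj; have [|] := leqP j i; last by lia.
move/(multichain_le x); rewrite leEboolean => /subsetP/(_ a aj).
by rewrite (negbTE aNi).
Qed.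

Lemma height_le x y : (forall a, height x a <= height y a) -> (x <= y)%O.
Proof.
move=> le_xy; rewrite le_multichain; apply/forallP=> i.
rewrite leEboolean; apply/subsetP => a; rewrite !mem_height => h.
by apply: leq_trans h _; rewrite leq_add2r.
Qed.

Lemma height_surj (f : 'I_n -> nat) : (forall a, f a <= k) ->
  exists x, height x =1 f.
Proof.
move=> fk.
(* Dictated by [mem_height]: [a] enters at position [k - f a]. *)
pose t : k.-tuple (boolean_algebra n) :=
  [tuple ([set a | k <= f a + i] : {set 'I_n}) | i < k].
have t_sorted : sorted <=%O t.
  apply: sorted_tuple_le => i j ltij; rewrite !tnth_mktuple leEboolean.
  by apply/subsetP => a; rewrite !inE; lia.
exists (Multichain t_sorted) => a; rewrite /height -[RHS](minn_idPl (fk a)).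
rewrite -card_ord_geq; apply: eq_card => i.
by rewrite !inE /= tnth_mktuple inE.
Qed.

Lemma card_level_height i :
  #|level M i| = #|[set f : {ffun 'I_n -> 'I_k.+1} | \sum_a f a == i]|.
Proof.
pose F x : {ffun 'I_n -> 'I_k.+1} := [ffun a => inord (height x a)].
have FE x a : F x a = height x a :> nat by rewrite ffunE inordK // ltnS height_leq.
have F_inj : injective F.
  move=> x y eqF; apply/Order.POrderTheory.le_anti.
  by rewrite !height_le // => a; rewrite -!FE eqF.
rewrite -(card_imset _ F_inj); apply: eq_card => f; rewrite !inE.
apply/imsetP/eqP => [[x] | sum_f].
  rewrite inE rank_height => /eqP <- ->; apply: eq_bigr => a _; exact: FE.
have [|x hx] := @height_surj (fun a => f a); first by move=> a; rewrite -ltnS.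
exists x; last by apply/ffunP => a; apply/ord_inj; rewrite FE hx.
by rewrite inE rank_height -sum_f; apply/eqP/eq_bigr => a _; rewrite hx.
Qed.

Lemma multichain_rank_log_concave : rank_log_concave M.
Proof.
case=> [|i] // _.
have := @log_concave_coefz k n (Posz i.+1) (Posz i.+1) (Order.POrderTheory.lexx _).
have -> : (Posz i.+1 - 1 = Posz i)%R by lia.
have -> : (Posz i.+1 + 1 = Posz i.+2)%R by lia.
by rewrite /coefz !coef_exp_geometric -!card_level_height !natz -!PoszM mulnn.
Qed.

Definition word x : seq nat := [seq height x a | a <- enum 'I_n].

Lemma size_word x : size (word x) = n.
Proof. by rewrite size_map size_enum_ord. Qed.

Lemma word_leq x : all (leq^~ k) (word x).
Proof. by apply/allP => _ /mapP[a _ ->]; apply: height_leq. Qed.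

Lemma sumn_word x : sumn (word x) = rank x.
Proof. by rewrite sumnE big_map big_enum rank_height. Qed.

Lemma word_le x y : all2 leq (word x) (word y) -> (x <= y)%O.
Proof.
move=> le_xy; apply: height_le => a.
move: le_xy; rewrite /word.
have := mem_enum 'I_n a; elim: (enum 'I_n) => //= b s IHs.
by rewrite !inE => /orP[/eqP <- /andP[]|/IHs IH /andP[_ /IH]].
Qed.

Lemma word_surj v : size v = n -> all (leq^~ k) v -> exists x, word x = v.
Proof.
move=> size_v /allP kv.
have [|x hx] := @height_surj (fun a => nth 0 v a).
  by move=> a; apply/kv/mem_nth; rewrite size_v.
exists x; rewrite /word (eq_map hx) (map_comp (nth 0 v) val) val_enum_ord.
by rewrite -size_v; apply: mkseq_nth.
Qed.

(** Summing over chains requires a finite index type, whence the image of the labels in place of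
    [seq nat]. *)
Definition chain_of x : seq_sub (codom (label k \o word)) :=
  SeqSub (codom_f (label k \o word) x).

Definition chain_bottom (t : seq_sub (codom (label k \o word))) := sumn (val t).

Lemma chain_of_eq x y :
  chain_of x = chain_of y <-> label k (word x) = label k (word y).
Proof. by split=> [/(congr1 val)|eq_xy] //; apply: val_inj. Qed.

Lemma chain_of_le x y : chain_of x = chain_of y -> rank x <= rank y -> (x <= y)%O.
Proof.
move=> /chain_of_eq eq_xy; rewrite -!sumn_word => le_xy.
by apply: word_le; apply: (label_le (word_leq x) (word_leq y)) le_xy.
Qed.

Lemma chain_of_rank x : chain_bottom (chain_of x) <= rank x
  <= poset_rank M - chain_bottom (chain_of x).
Proof. by have := label_rank (word_leq x); rewrite sumn_word size_word. Qed.

Lemma chain_of_saturated x r :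
  chain_bottom (chain_of x) <= r <= poset_rank M - chain_bottom (chain_of x) ->
  exists2 y, chain_of y = chain_of x & rank y = r.
Proof.
move=> range_r; have [|v [kv lab_v sum_v]] := @label_saturated k _ r (word_leq x).
  by rewrite size_word.
have size_v : size v = n by rewrite -(size_label k) lab_v size_label size_word.
have [y yv] := word_surj size_v kv.
by exists y; [apply/chain_of_eq; rewrite yv | rewrite -sumn_word yv].
Qed.

End BooleanMultichains.

Theorem theorem2p10 (n k : nat) :
  [/\ rank_log_concave (multichain (boolean_algebra n) k),
      strong_Sperner (multichain (boolean_algebra n) k),
      rank_unimodal (multichain (boolean_algebra n) k)
    & Sperner (multichain (boolean_algebra n) k)].
Proof.
have sS := scd_strong_Sperner (@chain_of_le n k) (@chain_of_rank n k)
  (@chain_of_saturated n k).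
split; [exact: multichain_rank_log_concave | exact: sS | | exact: sS].
exact: scd_rank_unimodal (@chain_of_le n k) (@chain_of_rank n k)
  (@chain_of_saturated n k).
Qed.
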